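(* Let $\alpha,\beta$ be two curves immersed in the hyperbolic space $\mathbb{H}^{3}$, with $\alpha=\alpha(s)$ of unit speed. Assume that $\alpha$ is the evolute of $\beta$ (and $\beta$ the involute of $\alpha$), let $f(s,\lambda)=\gamma_{\alpha'(s)}(\lambda)$ be a parametrization of the tangential surface to $\alpha$, and let $\beta(s)=\gamma_{\alpha'(s)}(\lambda(s))$ be a parametrization of $\beta$. Then the vector field $$N(s)=\gamma'_{\alpha'(s)}(\lambda(s))$$ is an RM vector field along $\beta$.
   Context: $\mathbb{H}^3$ is the complete, simply connected 3-dimensional Riemannian manifold of constant sectional curvature $-1$, with Levi-Civita connection $\nabla$. Curves and vector fields are smooth. For a tangent vector $v$ at $p\in\mathbb{H}^3$, $\gamma_v$ denotes the geodesic with $\gamma_v(0)=p$, $\gamma_v'(0)=v$, and $\gamma_v'(\lambda)$ its velocity at parameter $\lambda$. The tangent line of a curve at a point is the geodesic through that point tangent to the curve there. The tangential surface of a curve $\alpha$ is the ruled surface formed by the tangent lines of $\alpha$, parametrized by $f(s,\lambda)=\gamma_{\alpha'(s)}(\lambda)$. The curve $\alpha$ is called an evolute of $\beta$, and $\beta$ an involute of $\alpha$, if $\beta$ is contained in the tangential surface of $\alpha$ and meets the tangent lines of $\alpha$ orthogonally; $\beta$ is then parametrized as $\beta(s)=\gamma_{\alpha'(s)}(\lambda(s))$ for a smooth function $\lambda(s)$. A normal vector field $N$ along a curve $\beta$ is called a rotation minimizing (RM) vector field if it is parallel with respect to the normal connection of $\beta$; equivalently, $\nabla_{\beta'}N$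 is proportional to $\beta'$. *)

(* Defs.v *)
(* MathComp-Analysis.  Hyperbolic 3-space is the hyperboloid model: the upper
   sheet of <x, x> = -1 in R^4 with the Lorentzian form <., .>, which restricts
   to a Riemannian metric of curvature -1 on the tangent spaces. *)
From mathcomp Require Import all_boot all_order all_algebra.
From mathcomp Require Import all_classical all_reals all_analysis.

Set Implicit Arguments.
Unset Strict Implicit.
Unset Printing Implicit Defensive.

Import Order.TTheory GRing.Theory Num.Theory.
Import numFieldNormedType.Exports.

Local Open Scope classical_set_scope.
Local Open Scope ring_scope.

Definition lorentz (R : realType) (x y : 'rV[R]_4) : R :=
  \sum_(i < 3) x 0 (lift ord0 i) * y 0 (lift ord0 i) - x 0 ord0 * y 0 ord0.

Definition H3 (R : realType) : set 'rV[R]_4 :=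
  [set x | lorentz x x = -1 /\ 0 < x 0 ord0].

Definition tangent_H3 (R : realType) (p : 'rV[R]_4) : set 'rV[R]_4 :=
  [set v | lorentz p v = 0].

(* Only used on open sets, where two-sided derivatives at the points of I
   depend on the values of f on I alone. *)
Definition smooth_on (R : realType) (V : normedModType R) (I : set R)
    (f : R -> V) : Prop :=
  forall (n : nat) (s : R), I s -> derivable (derive1n n f) s 1.

Definition smooth_curve (R : realType) (I : set R) (c : R -> 'rV[R]_4) : Prop :=
  smooth_on I c /\ forall s, I s -> H3 (c s).

Definition immersed_curve (R : realType) (I : set R) (c : R -> 'rV[R]_4) :
    Prop :=
  smooth_curve I c /\ forall s, I s -> derive1 c s != 0.

Definition unit_speed (R : realType) (I : set R) (c : R -> 'rV[R]_4) : Prop :=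
  forall s, I s -> lorentz (derive1 c s) (derive1 c s) = 1.

Definition vector_field_along (R : realType) (I : set R)
    (c X : R -> 'rV[R]_4) : Prop :=
  smooth_on I X /\ forall s, I s -> tangent_H3 (c s) (X s).

(* The Levi-Civita derivative of X along c is the tangential part of X';
   c s is a normal of the hyperboloid at c s, with <c s, c s> = -1, hence the
   plus sign. *)
Definition cov_deriv (R : realType) (c X : R -> 'rV[R]_4) (s : R) :
    'rV[R]_4 :=
  derive1 X s + lorentz (derive1 X s) (c s) *: c s.

Definition is_geodesic (R : realType) (c : R -> 'rV[R]_4) : Prop :=
  smooth_curve setT c /\ forall t, cov_deriv c (derive1 c) t = 0.

(* The geodesic with initial position p and initial velocity v, by definite
   description; it exists and is unique for p in H3 and v tangent at p, and the
   constant curve is a dummy value for the other arguments. *)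
Definition geod (R : realType) (p v : 'rV[R]_4) : R -> 'rV[R]_4 :=
  xget (fun=> p) [set c | [/\ is_geodesic c, c 0 = p & derive1 c 0 = v]].

Definition tangential_map (R : realType) (alpha : R -> 'rV[R]_4) (s l : R) :
    'rV[R]_4 :=
  geod (alpha s) (derive1 alpha s) l.

(* alpha is an evolute of beta, with parameter function lambda: the second
   clause puts beta s on the tangent line of alpha at s, the third one is the
   orthogonality of beta and that line at beta s. *)
Definition evolute (R : realType) (I : set R) (alpha beta : R -> 'rV[R]_4)
    (lambda : R -> R) : Prop :=
  [/\ smooth_on I lambda,
      forall s, I s -> beta s = tangential_map alpha s (lambda s)
    & forall s, I s ->
        lorentz (derive1 beta s)
                (derive1 (tangential_map alpha s) (lambda s)) = 0].

Definition normal_field_along (R : realType) (I : set R)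
    (c X : R -> 'rV[R]_4) : Prop :=
  vector_field_along I c X /\
  forall s, I s -> lorentz (X s) (derive1 c s) = 0.

Definition normal_cov_deriv (R : realType) (c X : R -> 'rV[R]_4) (s : R) :
    'rV[R]_4 :=
  cov_deriv c X s -
  (lorentz (cov_deriv c X s) (derive1 c s) /
   lorentz (derive1 c s) (derive1 c s)) *: derive1 c s.

Definition RM_field (R : realType) (I : set R) (c X : R -> 'rV[R]_4) : Prop :=
  normal_field_along I c X /\ forall s, I s -> normal_cov_deriv c X s = 0.

(* Main.v *)
(* The geodesic from p with unit velocity v is cosh t p + sinh t v: its speed is
   constant, so the geodesic equation becomes c'' = c.  Hence
   beta = cosh l a + sinh l a' and N = sinh l a + cosh l a', and orthogonality
   of beta' to N forces l' = -1.  Then beta' = sinh l (a'' - a) and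
   N' = cosh l (a'' - a), where a'' - a is tangent to H^3 at beta, and sinh l <> 0
   as beta is immersed: the Levi-Civita derivative of N is coth l beta'. *)
Require Import Defs.
From mathcomp Require Import all_boot all_order all_algebra.
From mathcomp Require Import all_classical all_reals all_analysis.
From mathcomp Require Import ring lra.
Set Implicit Arguments.
Unset Strict Implicit.
Unset Printing Implicit Defensive.

Import Order.TTheory GRing.Theory Num.Theory.
Import numFieldNormedType.Exports.
Local Open Scope classical_set_scope.
Local Open Scope ring_scope.

(** * Derivatives of vector-valued functions of one real variable *)

Lemma derivable_is_derive1 (R : realType) (V : normedModType R) (f : R -> V)
    (s : R) :
  derivable f s 1 -> is_derive s 1 f (derive1 f s).
Proof. by move=> fs; rewrite derive1E; exact/derivableP. Qed.

Lemma is_derive1E (R : realType) (V : normedModType R) (f : R -> V) (s : R)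
    (d : V) :
  is_derive s 1 f d -> derive1 f s = d.
Proof. by move=> fs; rewrite derive1E; exact: derive_val. Qed.

Lemma near_open_eq (R : realType) (V : normedModType R) (I : set R)
    (f g : R -> V) (s : R) :
  open I -> I s -> (forall t, I t -> f t = g t) -> \forall t \near s, f t = g t.
Proof.
by move=> oI Is fg; near=> t; apply: fg; near: t; exact: open_nbhs_nbhs.
Unshelve. all: by end_near. Qed.

(** Formulas for the curves are known on [I] only; as [I] is open, they hold near each of its points
    and can be differentiated there. *)
Lemma is_derive_eq_on (R : realType) (V : normedModType R) (I : set R)
    (f g : R -> V) (s : R) (d : V) :
  open I -> I s -> (forall t, I t -> f t = g t) ->
  is_derive s 1 f d -> is_derive s 1 g d.
Proof. by move=> oI Is fg; apply: near_eq_is_derive; exact: near_open_eq fg. Qed.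

Lemma is_derive_scale (R : realType) (V : normedModType R) (f : R -> R)
    (X : R -> V) (s df : R) (dX : V) :
  is_derive s 1 f df -> is_derive s 1 X dX ->
  is_derive s 1 (fun t => f t *: X t) (df *: X s + f s *: dX).
Proof.
move=> [fs <-] [Xs <-].
suff H : (fun h : R => h^-1 *: (((fun t => f t *: X t) \o shift s) (h *: 1)
    - f s *: X s)) @ 0^' --> 'D_1 f s *: X s + f s *: 'D_1 X s.
  by split; [apply/cvg_ex; eexists; exact: H | exact: cvg_lim H].
(* The usual splitting of the difference quotient, with [X] taken at the shifted point in the first
   term; hence continuity of [X] at [s] is required below. *)
rewrite [X in X @ _](_ : _ = fun h : R =>
    (h^-1 *: ((f \o shift s) (h *: 1) - f s)) *: (X \o shift s) (h *: 1)
    + f s *: (h^-1 *: ((X \o shift s) (h *: 1) - X s))); last first.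
  apply/funext => h /=.
  rewrite [f s *: (h^-1 *: _)]scalerA [f s * _]mulrC -!scalerA -scalerDr.
  by congr (_ *: _); rewrite scalerBl scalerBr addrA subrK.
apply: cvgD; last exact: cvgZl_tmp.
apply: cvgZ; first exact: fs.
suff : {for 0, continuous (fun h : R => X (h *: 1 + s))}.
  by move=> /continuous_withinNx; rewrite scale0r add0r.
apply: differentiable_continuous; apply/derivable1_diffP.
exact: (derivable1P _ _ _).1.
Qed.

Lemma is_derive_mx_coord (R : realType) (m n : nat) (X : R -> 'M[R]_(m, n))
    (s : R) (dX : 'M[R]_(m, n)) (i : 'I_m) (j : 'I_n) :
  is_derive s 1 X dX -> is_derive s 1 (fun t => X t i j) (dX i j).
Proof.
move=> [Xs <-]; rewrite derive_mx // mxE; apply/derivableP.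
by move/derivable_mxP : Xs; apply.
Qed.

Lemma is_derive_0_is_cst_mx (R : realType) (m n : nat)
    (X : R -> 'M[R]_(m, n)) (x y : R) :
  (forall s : R, is_derive s (1 : R) X 0) -> X x = X y.
Proof.
move=> dX; apply/matrixP => i j.
apply: (@is_derive_0_is_cst R (fun t => X t i j)) => s.
by have := is_derive_mx_coord i j (dX s); rewrite mxE.
Qed.

(** * The Lorentzian form *)

Lemma lorentzE (R : realType) (x y : 'rV[R]_4) :
  lorentz x y = x 0 (lift ord0 0) * y 0 (lift ord0 0)
              + x 0 (lift ord0 1) * y 0 (lift ord0 1)
              + x 0 (lift ord0 ord_max) * y 0 (lift ord0 ord_max)
              - x 0 0 * y 0 0.
Proof.
rewrite /lorentz !big_ord_recl big_ord0 addr0 !addrA.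
by congr (_ + _ * _ + _ * _ - _); congr (_ _ _); exact: val_inj.
Qed.

Lemma lorentzC (R : realType) (x y : 'rV[R]_4) : lorentz x y = lorentz y x.
Proof. by rewrite !lorentzE; ring. Qed.

Lemma lorentzDl (R : realType) (x y z : 'rV[R]_4) :
  lorentz (x + y) z = lorentz x z + lorentz y z.
Proof. by rewrite !lorentzE !mxE; ring. Qed.

Lemma lorentzZl (R : realType) (a : R) (x z : 'rV[R]_4) :
  lorentz (a *: x) z = a * lorentz x z.
Proof. by rewrite !lorentzE !mxE; ring. Qed.

Lemma lorentzDr (R : realType) (x y z : 'rV[R]_4) :
  lorentz x (y + z) = lorentz x y + lorentz x z.
Proof. by rewrite !lorentzE !mxE; ring. Qed.

Lemma lorentzZr (R : realType) (a : R) (x z : 'rV[R]_4) :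
  lorentz x (a *: z) = a * lorentz x z.
Proof. by rewrite !lorentzE !mxE; ring. Qed.

Definition lorentz_bilin := (lorentzDl, lorentzDr, lorentzZl, lorentzZr).

Lemma is_derive_lorentz (R : realType) (X Y : R -> 'rV[R]_4) (s : R)
    (dX dY : 'rV[R]_4) :
  is_derive s 1 X dX -> is_derive s 1 Y dY ->
  is_derive s 1 (fun t => lorentz (X t) (Y t))
    (lorentz dX (Y s) + lorentz (X s) dY).
Proof.
move=> hX hY.
have hXY i : is_derive s 1 (fun t => X t 0 i * Y t 0 i)
    (dX 0 i * Y s 0 i + X s 0 i * dY 0 i).
  (* On [R] as a module over itself, scaling is convertible to multiplication. *)
  have := is_derive_scale (is_derive_mx_coord 0 i hX) (is_derive_mx_coord 0 i hY).
  exact.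
rewrite (_ : (fun t => _) = (fun t => X t 0 (lift ord0 0) * Y t 0 (lift ord0 0))
   + (fun t => X t 0 (lift ord0 1) * Y t 0 (lift ord0 1))
   + (fun t => X t 0 (lift ord0 ord_max) * Y t 0 (lift ord0 ord_max))
   - (fun t => X t 0 0 * Y t 0 0)); last by apply/funext => t; rewrite lorentzE.
apply: is_derive_eq.
by rewrite !lorentzE; ring.
Qed.

(** By Lagrange's identity the difference of the two sides is the squared norm of the cross
    product. *)
Lemma cauchy_schwarz3 (R : realType) (a b c x y z : R) :
  (a * x + b * y + c * z) ^+ 2 <=
  (a ^+ 2 + b ^+ 2 + c ^+ 2) * (x ^+ 2 + y ^+ 2 + z ^+ 2).
Proof.
rewrite -subr_ge0 [leRHS](_ : _ = (a * y - b * x) ^+ 2 +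
  (a * z - c * x) ^+ 2 + (b * z - c * y) ^+ 2); last by ring.
by rewrite !addr_ge0 // sqr_ge0.
Qed.

(** Suppose <v, v> <= 0, and let d, t be the time coordinates of p, v. The space part of v has
    square at most t^2, that of p has square d^2 - 1, and their product is d t by tangency.
    Cauchy-Schwarz gives d^2 t^2 <= (d^2 - 1) t^2, so t = 0 and then v = 0. *)
Lemma lorentz_tangent_gt0 (R : realType) (p v : 'rV[R]_4) :
  H3 p -> tangent_H3 p v -> v != 0 -> 0 < lorentz v v.
Proof.
move=> [pp p0] pv; rewrite /tangent_H3 /= in pv; apply: contra_neqT.
rewrite -leNgt; move: pp pv p0; rewrite !lorentzE.
set a := p 0 _; set b := p 0 _; set c := p 0 _; set d := p 0 _.
move=> pp pv p0.
have vE : forall i : 'I_4, [\/ i = 0, i = lift ord0 (0 : 'I_3),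
   i = lift ord0 (1 : 'I_3) | i = lift ord0 (ord_max : 'I_3)].
  by case=> [[|[|[|[|//]]]] ?];
    [constructor 1|constructor 2|constructor 3|constructor 4]; exact: val_inj.
move: pv.
set x := v 0 (lift ord0 0); set y := v 0 (lift ord0 1).
set z := v 0 (lift ord0 ord_max); set t := v 0 0 => pv vv.
have t2 : t ^+ 2 <= 0.
  have cs := cauchy_schwarz3 a b c x y z.
  have e1 : a * x + b * y + c * z = d * t by lra.
  have e2 : a ^+ 2 + b ^+ 2 + c ^+ 2 = d ^+ 2 - 1 by lra.
  have e3 : x ^+ 2 + y ^+ 2 + z ^+ 2 <= t ^+ 2 by lra.
  rewrite e1 e2 in cs.
  have d2 : 0 <= d ^+ 2 - 1 by rewrite -e2 !addr_ge0 // sqr_ge0.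
  have := ler_wpM2l d2 e3; rewrite exprMn in cs; lra.
have x2 := sqr_ge0 x; have y2 := sqr_ge0 y; have z2 := sqr_ge0 z.
have t2' := sqr_ge0 t.
have sq0 (r : R) : r ^+ 2 = 0 -> r = 0.
  by move/eqP; rewrite sqrf_eq0 => /eqP.
apply/rowP => i; rewrite mxE; case: (vE i) => ->; apply: sq0;
  rewrite -?/x -?/y -?/z -?/t; lra.
Qed.

(** * Smoothness *)

(* Differentiability to order n + 1 as a recursion on f, rather than on its
   last derivative as in smooth_on, so that the product rule goes through by
   induction. *)
Fixpoint diff_upto (R : realType) (V : normedModType R) (n : nat) (I : set R)
    (f : R -> V) : Prop :=
  (forall s, I s -> derivable f s 1) /\
  if n is m.+1 then diff_upto m I (derive1 f) else True.

Lemma diff_upto_derivable (R : realType) (V : normedModType R) (n : nat)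
    (I : set R) (f : R -> V) :
  diff_upto n I f -> forall s, I s -> derivable f s 1.
Proof. by case: n => [|n] []. Qed.

Lemma diff_uptoW (R : realType) (V : normedModType R) (n : nat) (I : set R)
    (f : R -> V) :
  diff_upto n.+1 I f -> diff_upto n I f.
Proof. by elim: n f => [|n IH] f [fI f'] //; split => //; exact: IH. Qed.

Lemma smooth_onP (R : realType) (V : normedModType R) (I : set R) (f : R -> V) :
  smooth_on I f <-> forall n, diff_upto n I f.
Proof.
split=> [fI n|fI n s Is].
  elim: n f fI => [|n IH] f fI; first by split => // s; exact: (fI 0%N).
  split; first by move=> s; exact: (fI 0%N).
  by apply: IH => k s Is; rewrite -derive1Sn; exact: fI.
elim: n f fI => [|n IH] f fI; first exact: (diff_upto_derivable (fI 0%N)).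
by rewrite derive1Sn; apply: IH => k; have [] := fI k.+1.
Qed.

Lemma diff_upto_eq (R : realType) (V : normedModType R) (n : nat) (I : set R)
    (f g : R -> V) :
  open I -> (forall s, I s -> f s = g s) -> diff_upto n I f -> diff_upto n I g.
Proof.
move=> oI; elim: n f g => [|n IH] f g fg [fI f'] //=; split.
- move=> s Is; apply: near_eq_derivable (fI _ Is); exact: near_open_eq fg.
- by [].
- move=> s Is; apply: near_eq_derivable (fI _ Is); exact: near_open_eq fg.
- apply: IH f' => s Is; apply/esym/is_derive1E.
  by apply: (is_derive_eq_on oI Is fg); exact: derivable_is_derive1 (fI _ Is).
Qed.

(** The inductive step of the closure lemmas below: an explicit formula on [I] may stand in for
    [derive1 f]. *)
Lemma diff_upto_derive (R : realType) (V : normedModType R) (n : nat)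
    (I : set R) (f g : R -> V) :
  open I -> (forall s, I s -> is_derive s 1 f (g s)) -> diff_upto n I g ->
  diff_upto n.+1 I f.
Proof.
move=> oI fg gI; split; first by move=> s /fg [].
by apply: diff_upto_eq gI => // s /fg /is_derive1E.
Qed.

Lemma diff_uptoD (R : realType) (V : normedModType R) (n : nat) (I : set R)
    (f g : R -> V) :
  open I -> diff_upto n I f -> diff_upto n I g -> diff_upto n I (f \+ g).
Proof.
move=> oI; elim: n f g => [|n IH] f g [fI f'] [gI g'].
  by split => // s Is; apply: derivableD; [exact: fI|exact: gI].
apply: (diff_upto_derive oI _ (IH _ _ f' g')) => s Is.
by apply: is_deriveD; apply: derivable_is_derive1; [exact: fI|exact: gI].
Qed.

Lemma diff_upto_scale (R : realType) (V : normedModType R) (n : nat)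
    (I : set R) (f : R -> R) (X : R -> V) :
  open I -> diff_upto n I f -> diff_upto n I X ->
  diff_upto n I (fun s => f s *: X s).
Proof.
move=> oI.
have dfX (g : R -> R) (Y : R -> V) s : derivable g s 1 -> derivable Y s 1 ->
    is_derive s 1 (fun s => g s *: Y s)
      (derive1 g s *: Y s + g s *: derive1 Y s).
  by move=> gs Ys; apply: is_derive_scale; exact: derivable_is_derive1.
elim: n f X => [|n IH] f X fI XI.
  split=> // s Is.
  by have [] := dfX _ _ s (diff_upto_derivable fI Is) (diff_upto_derivable XI Is).
apply: (@diff_upto_derive _ _ _ _ _
  ((fun s => derive1 f s *: X s) \+ (fun s => f s *: derive1 X s))) => //.
  by move=> s Is; apply: dfX; [case: fI => + _|case: XI => + _]; exact.
(* In each summand one factor is differentiated; the other one is weakened to the lower order. *)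
by apply: diff_uptoD => //; apply: IH; (try exact: diff_uptoW);
  [case: fI|case: XI].
Qed.

(** * Hyperbolic functions *)

Definition cosh (R : realType) (t : R) : R := (expR t + expR (- t)) / 2.
Definition sinh (R : realType) (t : R) : R := (expR t - expR (- t)) / 2.

Lemma cosh0 (R : realType) : cosh (0 : R) = 1.
Proof. by rewrite /cosh oppr0 expR0; field. Qed.

Lemma sinh0 (R : realType) : sinh (0 : R) = 0.
Proof. by rewrite /sinh oppr0 expR0 subrr mul0r. Qed.

Lemma cosh2B_sinh2 (R : realType) (t : R) : cosh t ^+ 2 - sinh t ^+ 2 = 1.
Proof.
by have := expRxMexpNx_1 t; rewrite /cosh /sinh => e; rewrite -[RHS]e; field.
Qed.

Lemma cosh_gt0 (R : realType) (t : R) : 0 < cosh t.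
Proof. by rewrite /cosh divr_gt0 // addr_gt0 // expR_gt0. Qed.

Lemma is_derive_cosh (R : realType) (t : R) : is_derive t 1 (@cosh R) (sinh t).
Proof.
have eN : is_derive t (1 : R) (fun t : R => expR (- t)) (expR (- t) * - 1).
  exact: (@is_derive1_comp R expR -%R).
rewrite (_ : @cosh R = 2^-1 \*: (expR + (fun t : R => expR (- t)))); last first.
  by apply/funext => u; rewrite /cosh mulrC.
apply: is_derive_eq; rewrite /sinh -[_ *: _]/(_ * _); ring.
Qed.

Lemma is_derive_sinh (R : realType) (t : R) : is_derive t 1 (@sinh R) (cosh t).
Proof.
have eN : is_derive t (1 : R) (fun t : R => expR (- t)) (expR (- t) * - 1).
  exact: (@is_derive1_comp R expR -%R).
rewrite (_ : @sinh R = 2^-1 \*: (expR - (fun t : R => expR (- t)))); last first.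
  by apply/funext => u; rewrite /sinh mulrC.
apply: is_derive_eq; rewrite /cosh -[_ *: _]/(_ * _); ring.
Qed.

(** Both claims go through one induction, since the derivative of each function contains the
    other. *)
Lemma diff_upto_cosh_sinh (R : realType) (n : nat) (I : set R) (l : R -> R) :
  open I -> diff_upto n I l ->
  diff_upto n I (fun s => cosh (l s)) /\ diff_upto n I (fun s => sinh (l s)).
Proof.
move=> oI.
have dch s : derivable l s 1 ->
    is_derive s 1 (fun s => cosh (l s)) (derive1 l s *: sinh (l s)).
  move=> ls; rewrite -[_ *: _]/(_ * _) mulrC.
  apply: (@is_derive1_comp R (@cosh R) l); first exact: is_derive_cosh.
  exact: derivable_is_derive1.
have dsh s : derivable l s 1 ->
    is_derive s 1 (fun s => sinh (l s)) (derive1 l s *: cosh (l s)).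
  move=> ls; rewrite -[_ *: _]/(_ * _) mulrC.
  apply: (@is_derive1_comp R (@sinh R) l); first exact: is_derive_sinh.
  exact: derivable_is_derive1.
elim: n => [|n IH] lI.
  by split; split => // s Is; have /= ls := diff_upto_derivable lI Is;
    [case: (dch s ls)|case: (dsh s ls)].
have [chI shI] := IH (diff_uptoW lI); case: lI => lI l'I.
by split; [apply: (diff_upto_derive oI (fun s Is => dch s (lI s Is)))
  |apply: (diff_upto_derive oI (fun s Is => dsh s (lI s Is)))];
  exact: diff_upto_scale.
Qed.

(** * Geodesics *)

(** For p in H^3 and v a unit tangent vector, this is the unit speed geodesic. Differentiation
    merely exchanges p and v. *)
Definition hyp_line (R : realType) (p v : 'rV[R]_4) (t : R) : 'rV[R]_4 :=
  cosh t *: p + sinh t *: v.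

Lemma is_derive_hyp_line (R : realType) (p v : 'rV[R]_4) (t : R) :
  is_derive t 1 (hyp_line p v) (hyp_line v p t).
Proof.
have dch := is_derive_scale (is_derive_cosh t) (is_derive_cst p t 1).
have dsh := is_derive_scale (is_derive_sinh t) (is_derive_cst v t 1).
apply: is_derive_eq (is_deriveD dch dsh) _.
by rewrite !scaler0 !addr0 /hyp_line addrC.
Qed.

Lemma derive1_hyp_line (R : realType) (p v : 'rV[R]_4) :
  derive1 (hyp_line p v) = hyp_line v p.
Proof. by apply/funext => t; exact/is_derive1E/is_derive_hyp_line. Qed.

Lemma smooth_hyp_line (R : realType) (p v : 'rV[R]_4) :
  smooth_on setT (hyp_line p v).
Proof.
move=> n s _; elim: n p v => [|n IH] p v.
  by case: (is_derive_hyp_line p v s).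
by rewrite derive1Sn derive1_hyp_line.
Qed.

Lemma hyp_line0 (R : realType) (p v : 'rV[R]_4) : hyp_line p v 0 = p.
Proof. by rewrite /hyp_line cosh0 sinh0 scale1r scale0r addr0. Qed.

Lemma lorentz_hyp_line (R : realType) (p v : 'rV[R]_4) (t : R) :
  lorentz p p = -1 -> lorentz p v = 0 -> lorentz v v = 1 ->
  lorentz (hyp_line p v t) (hyp_line p v t) = -1.
Proof.
move=> pp pv vv; rewrite /hyp_line !lorentz_bilin (lorentzC v p) pp pv vv.
by have := cosh2B_sinh2 t => e; lra.
Qed.

Lemma is_geodesic_hyp_line (R : realType) (p v : 'rV[R]_4) :
  H3 p -> tangent_H3 p v -> lorentz v v = 1 -> is_geodesic (hyp_line p v).
Proof.
move=> [pp p0] pv vv; rewrite /tangent_H3 /= in pv.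
have ll t := lorentz_hyp_line t pp pv vv.
split; first split; first exact: smooth_hyp_line.
- move=> t _; split; first exact: ll.
  rewrite /hyp_line !mxE.
  have t0 : 0 < cosh t by exact: cosh_gt0.
  have ch2 : cosh t ^+ 2 = 1 + sinh t ^+ 2 by rewrite -(cosh2B_sinh2 t) subrK.
  (* To stay on the upper sheet, the time coordinate must remain positive. With d, w the time
     coordinates of p, v, Cauchy-Schwarz on the space parts reads (d w)^2 <= (d^2 - 1) (w^2 + 1),
     which is this bound. *)
  have v0 : v 0 0 ^+ 2 + 1 <= p 0 0 ^+ 2.
    move: pp pv vv; rewrite !lorentzE.
    set a := p 0 _; set b := p 0 _; set c := p 0 _; set d := p 0 _.
    set x := v 0 _; set y := v 0 _; set z := v 0 _; set w := v 0 _.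
    move=> pp pv vv; have cs := cauchy_schwarz3 a b c x y z.
    have e1 : a * x + b * y + c * z = d * w by lra.
    have e2 : a ^+ 2 + b ^+ 2 + c ^+ 2 = d ^+ 2 - 1 by lra.
    have e3 : x ^+ 2 + y ^+ 2 + z ^+ 2 = w ^+ 2 + 1 by lra.
    rewrite e1 e2 e3 in cs; lra.
  have lt2 : (v 0 0 * sinh t) ^+ 2 < (p 0 0 * cosh t) ^+ 2.
    rewrite (exprMn _ (v 0 0)) (exprMn _ (p 0 0)) ch2; have sh0 := sqr_ge0 (sinh t).
    have := ler_wpM2r sh0 v0; have := exprn_gt0 2 p0; lra.
  have pc : 0 < p 0 0 * cosh t by exact: mulr_gt0.
  rewrite [cosh t * _]mulrC [sinh t * _]mulrC.
  (* From x > 0 and y^2 < x^2 to x + y > 0: otherwise x - y >= 0, and (x - y) (x + y) could not be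
     positive. *)
  move: (p 0 0 * cosh t) (v 0 0 * sinh t) pc lt2 => x y x0.
  rewrite -subr_gt0 subr_sqr ltNge => yx; rewrite ltNge; apply: contra yx => xy.
  rewrite mulr_ge0_le0 //; lra.
(* Here c'' = c, which is normal to the hyperboloid, so its tangential part vanishes. *)
- by move=> t; rewrite /cov_deriv !derive1_hyp_line ll // scaleN1r subrr.
Qed.

(** Source of all the relations between a curve and its derivatives used below. *)
Lemma lorentz_cst_derive (R : realType) (I : set R) (X Y : R -> 'rV[R]_4)
    (k s : R) (dX dY : 'rV[R]_4) :
  open I -> I s -> (forall t, I t -> lorentz (X t) (Y t) = k) ->
  is_derive s 1 X dX -> is_derive s 1 Y dY ->
  lorentz dX (Y s) + lorentz (X s) dY = 0.
Proof.
move=> oI Is XY hX hY; rewrite -(is_derive1E (is_derive_lorentz hX hY)).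
apply: is_derive1E.
by apply: (is_derive_eq_on oI Is _ (is_derive_cst k s (1 : R))) => t /XY.
Qed.

Lemma lorentz_velocity (R : realType) (I : set R) (c : R -> 'rV[R]_4) :
  open I -> smooth_curve I c -> forall s, I s -> lorentz (c s) (derive1 c s) = 0.
Proof.
move=> oI [cI cH] s Is.
have dc := derivable_is_derive1 (cI 0%N s Is).
have := lorentz_cst_derive oI Is (fun t It => (cH t It).1) dc dc.
by rewrite (lorentzC (derive1 c s)); lra.
Qed.

(** The geodesic equation makes c'' a multiple of c, hence orthogonal to c', so <c', c'> stays 1.
    Differentiating <c, c'> = 0 then gives <c'', c> = -1, which fixes the multiple. *)
Lemma geodesic_second_derivative (R : realType) (c : R -> 'rV[R]_4) :
  is_geodesic c -> lorentz (derive1 c 0) (derive1 c 0) = 1 ->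
  forall t, derive1 (derive1 c) t = c t.
Proof.
move=> [cC geo] v1.
have dc t : is_derive t (1 : R) c (derive1 c t).
  exact: derivable_is_derive1 (cC.1 0%N t I).
have ddc t : is_derive t (1 : R) (derive1 c) (derive1 (derive1 c) t).
  exact: derivable_is_derive1 (cC.1 1%N t I).
have cc' t : lorentz (c t) (derive1 c t) = 0.
  exact: (lorentz_velocity (@openT R) cC).
have c'' t : derive1 (derive1 c) t = - lorentz (derive1 (derive1 c) t) (c t) *: c t.
  by have /eqP := geo t; rewrite /cov_deriv addr_eq0 scaleNr => /eqP.
have norm t : lorentz (derive1 c t) (derive1 c t) = 1.
  rewrite -v1; apply: (@is_derive_0_is_cst R
    (fun t => lorentz (derive1 c t) (derive1 c t))) => s.
  apply: is_derive_eq (is_derive_lorentz (ddc s) (ddc s)) _.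
  by rewrite c'' !lorentz_bilin (lorentzC (derive1 c s)) cc' !mulr0 addr0.
move=> t; rewrite c''; set k := lorentz _ _.
have := lorentz_cst_derive (@openT R) I (fun t _ => cc' t) (dc t) (ddc t).
rewrite norm lorentzC -/k => e.
by rewrite (_ : k = -1) ?opprK ?scale1r //; lra.
Qed.

Lemma geodesicE (R : realType) (c : R -> 'rV[R]_4) :
  is_geodesic c -> lorentz (derive1 c 0) (derive1 c 0) = 1 ->
  c = hyp_line (c 0) (derive1 c 0).
Proof.
move=> geo v1; have c'' := geodesic_second_derivative geo v1.
case: geo => [[cT _] _].
have dc t : is_derive t (1 : R) c (derive1 c t).
  exact: derivable_is_derive1 (cT 0%N t I).
have ddc t : is_derive t (1 : R) (derive1 c) (c t).
  by rewrite -c''; exact: derivable_is_derive1 (cT 1%N t I).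
(* A solution of X' = Y, Y' = X, transported back to time 0 by the hyperbolic
   rotation, is constant. *)
have transport (X Y : R -> 'rV[R]_4) t :
    (forall s : R, is_derive s (1 : R) X (Y s)) ->
    (forall s : R, is_derive s (1 : R) Y (X s)) ->
    cosh t *: X t - sinh t *: Y t = X 0.
  move=> dX dY; have dE (s : R) :
      is_derive s (1 : R) (fun t => cosh t *: X t - sinh t *: Y t) 0.
    apply: is_derive_eq (is_deriveB
      (is_derive_scale (is_derive_cosh s) (dX s))
      (is_derive_scale (is_derive_sinh s) (dY s))) _.
    by rewrite [X in _ - X]addrC subrr.
  have := is_derive_0_is_cst_mx t 0 dE.
  by rewrite cosh0 sinh0 scale1r scale0r subr0.
(* The system is symmetric in c and c', so the second use recovers the initial velocity. Rotating
   both constants forward again yields c t, by cosh^2 - sinh^2 = 1. *)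
have e1 t := transport _ _ t dc ddc.
have e2 t := transport _ _ t ddc dc.
apply/funext => t; rewrite /hyp_line -(e1 t) -(e2 t).
apply/rowP => i; rewrite !mxE -[LHS]mul1r -[X in X * _](cosh2B_sinh2 t); ring.
Qed.

(** [hyp_line p v] meets the description, which excludes the dummy value; [geodesicE] shows that
    nothing else meets it. *)
Lemma geodE (R : realType) (p v : 'rV[R]_4) :
  H3 p -> tangent_H3 p v -> lorentz v v = 1 -> geod p v = hyp_line p v.
Proof.
move=> pH pv vv; rewrite /geod.
case: xgetP => [c -> [geo c0 c'0]|/(_ (hyp_line p v)) []].
  by rewrite (geodesicE geo) c'0 // c0.
split; [exact: is_geodesic_hyp_line|exact: hyp_line0|].
by rewrite derive1_hyp_line hyp_line0.
Qed.

(** * The rotation minimizing field along an involute *)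

Theorem corollary9 (R : realType) (I : set R) (hI : open I)
    (hI' : is_interval I) (alpha beta : R -> 'rV[R]_4) (lambda : R -> R)
    (halpha : immersed_curve I alpha) (hunit : unit_speed I alpha)
    (hbeta : immersed_curve I beta)
    (hevolute : evolute I alpha beta lambda) :
  RM_field I beta (fun s => derive1 (tangential_map alpha s) (lambda s)).
Proof.
case: halpha hbeta hevolute => [aC _] [bC b'0] [lS bE bperp].
have [aS aH] := aC; have [bS bH] := bC.
have aa' s : I s -> lorentz (alpha s) (derive1 alpha s) = 0.
  exact: lorentz_velocity.
have fE s : I s ->
    tangential_map alpha s = hyp_line (alpha s) (derive1 alpha s).
  move=> Is; rewrite /tangential_map; apply/funext => l.
  by rewrite geodE //; [exact: aH|exact: aa'|exact: hunit].
set N := fun s => _.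
(* The explicit form of [N], with point and velocity exchanged by the differentiation in l. The
   equality is claimed on [I] only, where [geod] is known to be [hyp_line]. *)
pose T s := hyp_line (derive1 alpha s) (alpha s) (lambda s).
have TN s : I s -> T s = N s by move=> Is; rewrite /N fE // derive1_hyp_line.
have da s : I s -> is_derive s (1 : R) alpha (derive1 alpha s).
  by move=> Is; exact: derivable_is_derive1 (aS 0%N s Is).
have dda s : I s ->
    is_derive s (1 : R) (derive1 alpha) (derive1 (derive1 alpha) s).
  by move=> Is; exact: derivable_is_derive1 (aS 1%N s Is).
have dl s : I s -> is_derive s (1 : R) lambda (derive1 lambda s).
  by move=> Is; exact: derivable_is_derive1 (lS 0%N s Is).
have NS : smooth_on I N.
  apply/smooth_onP => n; apply: (diff_upto_eq hI TN).
  have [cS sS] := diff_upto_cosh_sinh hI ((smooth_onP _ _).1 lS n).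
  (* One order more for [alpha], because its velocity enters [T]. *)
  have an := (smooth_onP _ _).1 aS n.+1.
  apply: diff_uptoD => //; apply: diff_upto_scale => //.
    by case: an.
  exact: diff_uptoW.
(* The product is ch sh (<a, a> + <a', a'>) = ch sh (-1 + 1). *)
have Ntan s : I s -> tangent_H3 (beta s) (N s).
  move=> Is; rewrite /tangent_H3 /= bE // fE // -TN // /T /hyp_line.
  rewrite !lorentz_bilin (lorentzC (derive1 alpha s)) aa' //.
  by rewrite hunit // (aH s Is).1; ring.
have Nnorm s : I s -> lorentz (N s) (derive1 beta s) = 0.
  by move=> Is; rewrite lorentzC bperp.
split; first by split.
move=> s Is; rewrite /normal_cov_deriv.
set a := alpha s; set a' := derive1 alpha s; set a'' := derive1 (derive1 alpha) s.
set ch := cosh (lambda s); set sh := sinh (lambda s); set l' := derive1 lambda s.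
have dch : is_derive s (1 : R) (fun s => cosh (lambda s)) (sh * l').
  by apply: (@is_derive1_comp R (@cosh R) lambda _ _ _ (is_derive_cosh _)); exact: dl.
have dsh : is_derive s (1 : R) (fun s => sinh (lambda s)) (ch * l').
  by apply: (@is_derive1_comp R (@sinh R) lambda _ _ _ (is_derive_sinh _)); exact: dl.
have b'E : derive1 beta s =
    (sh * l') *: a + ch *: a' + ((ch * l') *: a' + sh *: a'').
  apply: is_derive1E; apply: (is_derive_eq_on hI Is _ (is_deriveD
    (is_derive_scale dch (da s Is)) (is_derive_scale dsh (dda s Is)))).
  by move=> t It; rewrite bE // fE.
have N'E : derive1 N s =
    (sh * l') *: a' + ch *: a'' + ((ch * l') *: a + sh *: a').
  apply: is_derive1E; apply: (is_derive_eq_on hI Is TN (is_deriveD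
    (is_derive_scale dch (dda s Is)) (is_derive_scale dsh (da s Is)))).
have aa : lorentz a a = -1 by case: (aH s Is).
have a'a' : lorentz a' a' = 1 by exact: hunit.
have aa'0 : lorentz a a' = 0 by exact: aa'.
(* This and the next relation come from differentiating <a, a'> = 0 and <a', a'> = 1. *)
have aa'' : lorentz a a'' = -1.
  have := lorentz_cst_derive hI Is aa' (da s Is) (dda s Is).
  by rewrite -/a -/a' -/a'' a'a'; lra.
have a'a'' : lorentz a' a'' = 0.
  have := lorentz_cst_derive hI Is hunit (dda s Is) (dda s Is).
  by rewrite -/a' -/a'' lorentzC; lra.
have cs : ch ^+ 2 - sh ^+ 2 = 1 by exact: cosh2B_sinh2.
(* Expanded, <N, beta'> = 0 reads (ch^2 - sh^2) (1 + l') = 0. *)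
have l'E : l' = -1.
  have := Nnorm s Is; rewrite -TN // /T b'E /hyp_line -/a -/a' -/ch -/sh.
  rewrite !lorentz_bilin (lorentzC a' a) aa a'a' aa'0 aa'' a'a''.
  move=> e; rewrite -[LHS]mul1r -cs; lra.
have b's : derive1 beta s = sh *: (a'' - a).
  rewrite b'E l'E; apply/rowP => i; rewrite !mxE; ring.
have N's : derive1 N s = ch *: (a'' - a).
  rewrite N'E l'E; apply/rowP => i; rewrite !mxE; ring.
have sh0 : sh != 0.
  by have := b'0 s Is; rewrite b's; apply: contra_neq => ->; rewrite scale0r.
(* As a'' - a is orthogonal to a and a', hence to beta, the covariant derivative of [N] is its plain
   derivative. *)
have N'b : lorentz (derive1 N s) (beta s) = 0.
  rewrite N's bE // fE // /hyp_line -/a -/a' -/ch -/sh -scaleN1r !lorentz_bilin.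
  rewrite (lorentzC a'' a) (lorentzC a'' a') aa aa'' aa'0 a'a''; ring.
(* The normal projection divides by <beta', beta'>. The form is indefinite, so beta' <> 0 suffices
   only because beta' is tangent to H^3. *)
have b'pos : 0 < lorentz (derive1 beta s) (derive1 beta s).
  apply: (lorentz_tangent_gt0 (bH s Is)); last exact: b'0.
  exact: (lorentz_velocity hI bC).
have N'b' : derive1 N s = (ch / sh) *: derive1 beta s.
  by rewrite N's b's scalerA divfK.
(* A multiple of beta' equals its own projection onto beta', so nothing normal remains. *)
rewrite /cov_deriv N'b scale0r addr0 N'b' lorentzZl mulfK ?subrr //.
exact: lt0r_neq0.
Qed.
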